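(* Let $G$ be a finite undirected graph (multiple edges and loops allowed). Fix a reference orientation $O_{\mathrm{ref}}$ of $G$, a total order $<$ on $E(G)$, and arbitrary sign labels $\sigma_u,\sigma_b\colon E(G)\to\{+,-\}$. Then there exists a $2^{|E(G)|}$-to-one surjection $\varphi\colon\mathcal{O}^4(G)\to\mathcal{S}(G)$ such that: (a) the map $O\mapsto(\varphi(O),O^o)$ is a bijection between $\mathcal{O}^4(G)$ and $\mathcal{S}(G)\times\mathcal{S}(G)$; (b) $O^u\cap\varphi(O)=\varnothing$ and $O^b\subseteq\varphi(O)$ for all $O\in\mathcal{O}^4(G)$; (c) setting $I(O):=\hat I(\varphi(O))$ and $L(O):=\hat L(\varphi(O))$, where $\hat I,\hat L$ are the generalized activities with respect to $<$, the resulting maps $I,L\colon\mathcal{O}^4(G)\to\mathcal{S}(G)$ satisfy, for every $O\in\mathcal{O}^4(G)$, $I(O)\cap O^o=I^o(O)$, $I(O)\cap O^u=I^u(O)$, $L(O)\cap O^o=L^o(O)$ and $L(O)\cap O^b=L^b(O)$, where $I^o(O),I^u(O),L^o(O),L^b(O)$ are the sets defined in the context; (d) with $I^{\pm}(O):=I(O)\cap O^{\pm}$ and $L^{\pm}(O):=L(O)\cap O^{\pm}$, we have $I^+(O)\subseteq\varphi(O)$, $I^-(O)\cap\varphi(O)=\varnothing$, $L^-(O)\subseteq\varphi(O)$ and $L^+(O)\cap\varphi(O)=\varnothing$ for all $O\in\mathcal{O}^4(G)$; (e) if $O^o=\varnothing$ then $I(O)=\hat I(O^b)$ and $L(O)=\hat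 L(O^b)$.
   Context: $\mathcal{S}(G):=2^{E(G)}$ is the set of spanning subgraphs of $G$, identified with subsets of $E(G)$. A reference orientation $O_{\mathrm{ref}}$ chooses for each edge $e=\{a,b\}$ a positive direction $e^+=(a,b)$ and hence a negative direction $e^-=(b,a)$; $e^+$ and $e^-$ are distinct formal symbols even when $e$ is a loop. Put $\mathbb{E}(G):=\{e^+,e^-\colon e\in E(G)\}$. A fourientation of $G$ is an arbitrary subset $O\subseteq\mathbb{E}(G)$; $\mathcal{O}^4(G)$ is the set of all fourientations. In $O$ an edge $e$ is unoriented if $\{e^+,e^-\}\cap O=\varnothing$, bioriented if $\{e^+,e^-\}\subseteq O$, and oriented otherwise. $O^u,O^b,O^o\subseteq E(G)$ denote the sets of unoriented, bioriented and oriented edges; $O^+$ (resp. $O^-$) is the set of oriented edges $e\in O^o$ with $e^+\in O$ (resp. $e^-\in O$). A cut of $G$ is a minimal nonempty set of edges whose removal increases the number of connected components; it is the set of edges joining some $X\subset V(G)$ to its complement, and has two consistent orientations (out of $X$, into $X$). A cycle is (the edge set of) a simple cycle of $G$ (a loop is a cycle of length one), and has two consistent orientations. A directed cut (cycle) $C$ is a cut (cycle) with one of its two consistent orientations chosen; $\mathbb{E}(C)\subseteq\mathbb{E}(G)$ is its set of directed edges. A directed cut $Cu$ is a potential cut of a fourientation $O$ if $e^\delta\in\mathbb{E}(Cu)$ implies $e^{-\delta}\notin O$ (for $\delta\in\{+,-\}$). A directed cycle $Cy$ is a potential cycle of $O$ if $e^\delta\in\mathbb{E}(Cy)$ implies $e^\delta\in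 O$. ''Min edge'' means minimum with respect to $<$. For $O\in\mathcal{O}^4(G)$ define $I^o(O):=\{e\in O^o\colon e$ is the min edge in some potential cut of $O\}$; $L^o(O):=\{e\in O^o\colon e$ is the min edge in some potential cycle of $O\}$; $I^u(O):=\{e\in O^u\colon e$ is the min edge in some potential cut of $O\cup\{e^{\sigma_u(e)}\}\}$; $L^b(O):=\{e\in O^b\colon e$ is the min edge in some potential cycle of $O\setminus\{e^{\sigma_b(e)}\}\}$. Generalized activities of subgraphs: for $S\in\mathcal{S}(G)$, $\hat I(S)$ is the set of edges $e\in E(G)$ such that $e$ is the min edge of some cut of $G$ disjoint from $S\setminus\{e\}$, and $\hat L(S)$ is the set of edges $e\in E(G)$ such that $e$ is the min edge of some cycle of $G$ contained in $S\cup\{e\}$. *)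

(* Defs.v *)
From mathcomp Require Import all_boot.

Set Implicit Arguments.
Unset Strict Implicit.
Unset Printing Implicit Defensive.

(** The set [ends e] is a singleton exactly when [e] is a loop. *)
Record multigraph := Multigraph {
  vertex : finType;
  edge : finType;
  ends : edge -> {set vertex};
  card_ends : forall e, 0 < #|ends e| <= 2
}.

Record orientation (G : multigraph) := Orientation {
  ref_tail : edge G -> vertex G;
  ref_head : edge G -> vertex G;
  ref_ends : forall e, ends e = [set ref_tail e; ref_head e]
}.

(** Signs are booleans, [true] being [+]; the pair [(e, true)] is [e^+] and
    [(e, false)] is [e^-], distinct also when [e] is a loop. *)
Notation sign := bool.
Notation arc G := (edge G * sign)%type.
Notation subgraph G := {set edge G}.
Notation fourientation G := {set arc G}.

Section Graph.
Variable G : multigraph.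
Implicit Types (S C : subgraph G) (X : {set vertex G}).

Definition adjacent S : rel (vertex G) :=
  fun u v => [exists e in S, ends e == [set u; v]].

Definition components S : nat := n_comp (adjacent S) predT.

Definition disconnecting S : bool :=
  (S != set0) && (components [set: edge G] < components (~: S)).

Definition is_cut C : bool := minset disconnecting C.

Definition joining X : subgraph G :=
  [set e | (ends e :&: X != set0) && (ends e :&: ~: X != set0)].

(** The pairs [(v_i, e_i)] list a closed walk in which [e_i] joins [v_i] to
    [v_(i+1)], indices being cyclic.  Distinctness of the edges matters only for
    length two, where it rules out traversing one edge back and forth. *)
Definition simple_closed_walk (p : seq (vertex G * edge G)) : bool :=
  [&& p != [::], cycle (fun x y => ends x.2 == [set x.1; y.1]) p,
      uniq (map fst p) & uniq (map snd p)].

(** A cycle has as many steps as edges, so quantifying over walks of length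
    [#|C|] loses nothing and keeps the predicate boolean; see [is_cycleP]. *)
Definition is_cycle C : bool :=
  [exists p : #|C|.-tuple (vertex G * edge G),
    simple_closed_walk p && (C == [set e in map snd p])].

Lemma is_cycleP C :
  reflect (exists2 p, simple_closed_walk p & C = [set e in map snd p])
          (is_cycle C).
Proof.
apply: (iffP existsP) => [[p /andP[wp /eqP Cp]]|[p wp Cp]]; first by exists p.
have sz : size p == #|C|.
  case/and4P: wp => _ _ _ up.
  by rewrite Cp cardsE (card_uniqP up) size_map.
by exists (Tuple sz); rewrite wp; apply/eqP.
Qed.

End Graph.

Section Directed.
Variables (G : multigraph) (R : orientation G).
Implicit Types (d : arc G) (D : {set arc G}).

Definition arc_tail d : vertex G :=
  if d.2 then ref_tail R d.1 else ref_head R d.1.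
Definition arc_head d : vertex G :=
  if d.2 then ref_head R d.1 else ref_tail R d.1.

Definition underlying D : subgraph G := [set d.1 | d in D].

Definition out_arcs (X : {set vertex G}) : {set arc G} :=
  [set d | (arc_tail d \in X) && (arc_head d \notin X)].

(** Orienting a cut into [X] is orienting it out of [~: X]. *)
Definition is_dicut D : bool :=
  [exists X : {set vertex G}, is_cut (joining X) && (D == out_arcs X)].

Definition simple_closed_diwalk (p : seq (arc G)) : bool :=
  cycle (fun d d' => arc_head d == arc_tail d') p
  && simple_closed_walk [seq (arc_tail d, d.1) | d <- p].

Definition is_dicycle D : bool :=
  [exists p : #|D|.-tuple (arc G),
    simple_closed_diwalk p && (D == [set d in tval p])].

Lemma is_dicycleP D :
  reflect (exists2 p, simple_closed_diwalk p & D = [set d in p])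
          (is_dicycle D).
Proof.
apply: (iffP existsP) => [[p /andP[wp /eqP Dp]]|[p wp Dp]]; first by exists p.
have sz : size p == #|D|.
  case/andP: wp => _ /and4P[_ _ _]; rewrite -map_comp => /map_uniq up.
  by rewrite Dp cardsE (card_uniqP up).
by exists (Tuple sz); rewrite wp; apply/eqP.
Qed.

Definition potential_cut (O : fourientation G) D : bool :=
  is_dicut D && [forall d in D, (d.1, ~~ d.2) \notin O].

Definition potential_cycle (O : fourientation G) D : bool :=
  is_dicycle D && (D \subset O).

End Directed.

Section EdgeTypes.
Variables (G : multigraph) (O : fourientation G).

Definition unoriented : subgraph G :=
  [set e | ((e, true) \notin O) && ((e, false) \notin O)].
Definition bioriented : subgraph G :=
  [set e | ((e, true) \in O) && ((e, false) \in O)].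
Definition oriented : subgraph G := ~: (unoriented :|: bioriented).
Definition oriented_pos : subgraph G := [set e in oriented | (e, true) \in O].
Definition oriented_neg : subgraph G := [set e in oriented | (e, false) \in O].

End EdgeTypes.

Section Activities.
Variables (G : multigraph) (lt : rel (edge G)).

Definition strict_total_order : Prop :=
  [/\ irreflexive lt, transitive lt & forall e f, e != f -> lt e f || lt f e].

Definition min_edge (e : edge G) (C : subgraph G) : bool :=
  (e \in C) && [forall f in C, (f != e) ==> lt e f].

Definition Ihat (S : subgraph G) : subgraph G :=
  [set e | [exists C : subgraph G,
    [&& is_cut C, [disjoint C & S :\ e] & min_edge e C]]].

Definition Lhat (S : subgraph G) : subgraph G :=
  [set e | [exists C : subgraph G,
    [&& is_cycle C, C \subset e |: S & min_edge e C]]].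

Variables (R : orientation G) (sigma_u sigma_b : edge G -> sign).
Variable O : fourientation G.

Definition min_in_potential_cut (O' : fourientation G) (e : edge G) : bool :=
  [exists D : {set arc G}, potential_cut R O' D && min_edge e (underlying D)].

Definition min_in_potential_cycle (O' : fourientation G) (e : edge G) : bool :=
  [exists D : {set arc G}, potential_cycle R O' D && min_edge e (underlying D)].

Definition Io : subgraph G := [set e in oriented O | min_in_potential_cut O e].
Definition Lo : subgraph G :=
  [set e in oriented O | min_in_potential_cycle O e].
Definition Iu : subgraph G :=
  [set e in unoriented O | min_in_potential_cut ((e, sigma_u e) |: O) e].
Definition Lb : subgraph G :=
  [set e in bioriented O | min_in_potential_cycle (O :\ (e, sigma_b e)) e].

End Activities.

(* Main.v *)
From mathcomp Require Import all_boot.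
Require Import Defs.

(** Edges are processed from the largest to the smallest.  An edge that is oriented when its turn
    comes is settled: it becomes bioriented and enters [phi O], or unoriented and stays out.

    Being the minimum of a potential cut or cycle is a statement about directed reachability: with
    [d] the direction of the edge, it says whether [tail d] can be reached from [head d] by the
    larger arcs, after contracting the smaller edges for cuts and deleting them for cycles.  So
    settling [e] concerns only the queries "is [tail d] reachable from [head d]?" of edges smaller
    than [e].  Let [r0], [r+], [r-], [r+-] be the answers to one query when the arcs of [e]
    present are none, [e^+], [e^-], both.  Then [r0 = r+ && r-] and [r+- = r+ || r-]; hence
    unorienting [e^+] and biorienting [e^-] are harmless under the same condition
    [r+ -> r-] for all queries, and the two remaining moves under [r- -> r+].  An elimination
    argument shows that one of these conditions always holds.  Thus one can settle [e] by
    biorienting exactly one of its two orientations, which makes [O |-> (phi O, O^o)] injective;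
    the choice is free, up to (d), when both conditions hold. *)

Set Implicit Arguments.
Unset Strict Implicit.
Unset Printing Implicit Defensive.

Definition flip (G : multigraph) (d : arc G) : arc G := (d.1, ~~ d.2).

Lemma flipK (G : multigraph) : involutive (@flip G).
Proof. by case=> e b; rewrite /flip /= negbK. Qed.

Lemma same_edge (G : multigraph) (d d' : arc G) :
  d'.1 = d.1 -> d' = d \/ d' = flip d.
Proof.
case: d d' => [e b] [_ b'] /= ->.
by case: b b' => [] []; [left | right | right | left].
Qed.

(** * Directed reachability along a set of arcs *)

Section Reachability.
Variables (G : multigraph) (R : orientation G).
Implicit Types (d : arc G) (D : {set arc G}) (u v : vertex G).

Notation head := (arc_head R).
Notation tail := (arc_tail R).

Lemma tail_flip d : tail (flip d) = head d.
Proof. by case: d => e []. Qed.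

Lemma head_flip d : head (flip d) = tail d.
Proof. by case: d => e []. Qed.

Lemma ends_arc d : ends d.1 = [set tail d; head d].
Proof. by case: d => e []; rewrite (ref_ends R) // setUC. Qed.

Definition reach D : rel (vertex G) :=
  connect (fun u v => [exists d in D, (tail d == u) && (head d == v)]).

Lemma reach_refl D u : reach D u u.
Proof. exact: connect0. Qed.

Lemma reach_trans D v u w : reach D u v -> reach D v w -> reach D u w.
Proof. exact: connect_trans. Qed.

Lemma reach_arc D d : d \in D -> reach D (tail d) (head d).
Proof. by move=> dD; apply: connect1; apply/existsP; exists d; rewrite dD !eqxx. Qed.

Lemma reach_closed D (X : {set vertex G}) u v :
    (forall d, d \in D -> tail d \in X -> head d \in X) ->
  u \in X -> reach D u v -> v \in X.
Proof.
move=> clX uX /connectP[p + ->]; elim: p u uX => //= w p IH u uX.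
case/andP=> /exists_inP[d dD /andP[/eqP du /eqP dw]]; apply: IH.
by rewrite -dw clX // du.
Qed.

Lemma reach_sub D D' u v :
    (forall d, d \in D -> reach D' (tail d) (head d)) ->
  reach D u v -> reach D' u v.
Proof.
move=> sDD' uv; have: v \in [set w | reach D' u w].
  apply: reach_closed uv; last by rewrite inE reach_refl.
  by move=> d dD; rewrite !inE => /reach_trans; apply; apply: sDD'.
by rewrite inE.
Qed.

Lemma reach_mono D D' u v : D \subset D' -> reach D u v -> reach D' u v.
Proof. by move=> /subsetP sDD'; apply: reach_sub => d /sDD'/reach_arc. Qed.

(** One use of [d] suffices: of a walk using it repeatedly, only the part before the first use and
    the part after the last one matter. *)
Lemma reach_setU1 D d u v :
  reach (d |: D) u v = reach D u v || reach D u (tail d) && reach D (head d) v.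
Proof.
have mono : forall x y, reach D x y -> reach (d |: D) x y.
  by move=> x y; apply: reach_mono; apply: subsetUr.
apply/idP/orP => [uv|[/mono //|/andP[/mono ud /mono dv]]]; last first.
  by apply: reach_trans ud (reach_trans (reach_arc _) dv); rewrite setU11.
have: v \in [set w | reach D u w || reach D u (tail d) && reach D (head d) w].
  apply: reach_closed uv; last by rewrite inE reach_refl.
  move=> d'; rewrite !inE => /orP[/eqP-> /orP[-> |/andP[-> _]] /=|d'D].
  - by rewrite reach_refl orbT.
  - by rewrite reach_refl orbT.
  case/orP=> [ud'|/andP[-> dd']]; first by rewrite (reach_trans ud' (reach_arc d'D)).
  by rewrite (reach_trans dd' (reach_arc d'D)) orbT.
by rewrite inE => /orP.
Qed.

Lemma reach_addP D d u v :
  reflect (reach D u v \/ reach D u (tail d) /\ reach D (head d) v)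
          (reach (d |: D) u v).
Proof.
rewrite reach_setU1; apply: (iffP orP) => [[|/andP[]]|[|[-> ->]]]; by auto.
Qed.

(** If [d] is needed in the one set and [flip d] in the other, the first half of the second walk and
    the second half of the first meet at [head d] and avoid both arcs. *)
Lemma reach_flipI D d u v :
  reach (d |: D) u v && reach (flip d |: D) u v = reach D u v.
Proof.
apply/andP/idP => [[/reach_addP[//|[ud dv]] /reach_addP[//|]]|uv].
  by rewrite tail_flip head_flip => -[uh tv]; apply: reach_trans uh dv.
by split; apply/reach_addP; left.
Qed.

(** A walk using both arcs comes back to an end of the edge, and the detour in between can be cut
    out. *)
Lemma reach_flipU D d u v :
  reach (d |: (flip d |: D)) u v = reach (d |: D) u v || reach (flip d |: D) u v.
Proof.
apply/reach_addP/orP => [[|[]]|[/reach_addP[uv|[ut hv]]|]].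
- by right.
- case/reach_addP=> [ut|[uh _]]; case/reach_addP=> [hv|[_ tv]].
  + by left; apply/reach_addP; right.
  + by left; apply/reach_addP; left; rewrite head_flip in tv; apply: reach_trans ut tv.
  + by left; apply/reach_addP; left; rewrite tail_flip in uh; apply: reach_trans uh hv.
  + by right; apply/reach_addP; right.
- by left; apply/reach_addP; left.
- by right; split; apply/reach_addP; left.
- by left.
Qed.

End Reachability.

(** * Directed cycles as return walks *)

Section Cycles.
Variables (G : multigraph) (R : orientation G).
Implicit Types (d : arc G) (D : {set arc G}) (p : seq (arc G)).

Notation head := (arc_head R).
Notation tail := (arc_tail R).
Notation chain := (fun d d' => arc_head R d == arc_tail R d').

(** Distinct vertices force distinct edges, since a repeated edge would bring the walk back to [u].
    The last clause lets an arc ending at [u] be put in front, even when [p] is empty. *)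
Lemma trail_of_path D u (s : seq (vertex G)) :
    path (fun u v => [exists d in D, (tail d == u) && (head d == v)]) u s ->
    uniq (u :: s) ->
  exists p, [/\ {subset p <= D}, map head p = s, map tail p = belast u s,
    uniq (map fst p) & forall d, head d = u -> path chain d p].
Proof.
elim: s u => [|v s IH] u; first by exists [::].
rewrite [path _ _ _]/= => /andP[/exists_inP[d dD /andP[/eqP tu /eqP hv]] pth].
rewrite [uniq _]/= => /andP[uvs uq]; have [p [sp hp tp up cp]] := IH v pth uq.
exists (d :: p); split=> /=; rewrite ?hv ?tu ?hp ?tp //.
- by move=> d'; rewrite inE => /orP[/eqP->|/sp].
- rewrite up andbT; apply: contra uvs => /mapP[d' d'p dd'].
  have [hd' td'] : head d' \in v :: s /\ tail d' \in v :: s.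
    rewrite -{1}hp inE map_f // orbT; split=> //.
    by apply: mem_belast; rewrite -tp map_f.
  by rewrite -tu; have [->|->] := same_edge dd'; rewrite ?tail_flip.
- by move=> d' d'u; rewrite d'u eqxx cp.
Qed.

Lemma reach_chain D d d' p :
  path chain d (rcons p d') -> {subset p <= D} -> reach R D (head d) (tail d').
Proof.
elim: p d => [|d1 p IH] d /=; first by rewrite andbT => /eqP-> _; apply: reach_refl.
case/andP=> /eqP-> pth sp; apply: reach_trans (reach_arc _ _) (IH _ pth _).
  by apply: sp; rewrite mem_head.
by move=> d2 d2p; apply: sp; rewrite inE d2p orbT.
Qed.

(** The return walk is shortened to a simple path and closed by [d]. As [D] avoids the edge of [d],
    the edges stay distinct, also in a cycle of length two. *)
Lemma dicycle_of_reach D d : (forall d', d' \in D -> d'.1 != d.1) ->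
    reach R D (head d) (tail d) ->
  exists2 C, is_dicycle R C & (d \in C) && (C \subset d |: D).
Proof.
move=> Dd /connectP[s0 pth].
case/shortenP: pth => s pth uq _ last_s.
have [p [sp hp tp up cp]] := trail_of_path pth uq.
exists [set d' in d :: p]; last first.
  rewrite !inE eqxx; apply/subsetP => d'; rewrite !inE.
  by case/orP=> [->|/sp->]; rewrite ?orbT.
apply/is_dicycleP; exists (d :: p) => //; have cyc : cycle chain (d :: p).
  by rewrite /= rcons_path cp // -last_map hp last_s eqxx.
rewrite /simple_closed_diwalk cyc /simple_closed_walk -!map_comp /=.
apply/and3P; split.
- have/= := cyc; rewrite -map_rcons path_map.
  by apply: sub_path => d1 d2 /= /eqP <-; rewrite (ends_arc R).
- have -> : map (fst \o (fun d0 => (tail d0, d0.1))) p = map tail p by [].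
  by rewrite tp last_s -rcons_uniq -lastI.
- have -> : map (snd \o (fun d0 => (tail d0, d0.1))) p = map fst p by [].
  rewrite up andbT; apply/mapP => -[d' /sp/Dd/eqP]; by move/nesym.
Qed.

Lemma reach_of_dicycle D d : is_dicycle R D -> d \in D ->
  reach R [set d' in D | d'.1 != d.1] (head d) (tail d).
Proof.
case/is_dicycleP=> p0 /andP[cyc /and4P[_ _ _]]; rewrite -map_comp => ue ->.
rewrite inE => /rot_to[i p rp].
move: cyc ue; rewrite -(rot_cycle i) rp /= => pth.
rewrite -(rot_uniq i) -map_rot rp /= => /andP[dp _].
apply: reach_chain pth _ => d' d'p.
rewrite !inE -(mem_rot i) rp inE d'p orbT /=.
by apply: contra dp => /eqP <-; apply/mapP; exists d'.
Qed.

Lemma head_of_ends d u v : ends d.1 = [set u; v] -> tail d = u -> head d = v.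
Proof.
rewrite (ends_arc R) => E tu; rewrite tu in E.
have: head d \in [set u; v] by rewrite -E set22.
have: v \in [set u; head d] by rewrite E set22.
by rewrite !inE => /orP[] /eqP vu /orP[] /eqP hu; congruence.
Qed.

Lemma cycle_dicycle (C : subgraph G) :
  is_cycle C <-> exists2 D, is_dicycle R D & underlying D = C.
Proof.
have undE p : underlying [set d in p] = [set e in map fst p] :> subgraph G.
  apply/setP=> e; rewrite inE; apply/imsetP/mapP => -[d dp ->]; exists d => //.
    by rewrite inE in dp.
  by rewrite inE.
split=> [/is_cycleP[p wp ->]|[_ /is_dicycleP[p wp ->] <-]]; last first.
  case/andP: wp => _ wp; apply/is_cycleP; eexists; first exact: wp.
  by rewrite undE -map_comp.
(* Each edge is directed away from the vertex listed with it; a loop gets the sign [true]. *)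
pose f (x : vertex G * edge G) : arc G := (x.2, ref_tail R x.2 == x.1).
have tf x : x.1 \in ends x.2 -> tail (f x) = x.1.
  case: x => u e; rewrite (ref_ends R) !inE /f /arc_tail /=.
  by rewrite eq_sym; case: eqP => //= _ /eqP.
have tp x : x \in p -> tail (f x) = x.1.
  move=> xp; apply: tf; case/and4P: wp => _ cyc _ _.
  by rewrite (eqP (next_cycle cyc xp)) set21.
have fK : [seq (tail (f x), (f x).1) | x <- p] = p.
  rewrite -[RHS]map_id; apply/eq_in_map => x /tp ->; by case: x.
exists [set d in map f p]; last by rewrite undE -map_comp.
apply/is_dicycleP; exists (map f p) => //; rewrite /simple_closed_diwalk.
rewrite -map_comp fK wp andbT cycle_map.
case/and4P: wp => _ cyc _ _; move: cyc; apply: sub_in_cycle (allss p).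
move=> x y /= /tp tx /tp ty /eqP E; rewrite ty; apply/eqP.
exact: (@head_of_ends (f x) _ _ E tx).
Qed.

End Cycles.

(** * Strict comparison of component counts *)

Section Components.
Variables (T : finType) (e1 e2 : rel T).
Hypotheses (sym1 : connect_sym e1) (sym2 : connect_sym e2).
Hypothesis sub12 : subrel (connect e1) (connect e2).

(** Sending each root of [e2] to its root for [e1] is injective. It misses the [e1]-root of [x] or
    of [y]: these differ, but both could only come from the common [e2]-root. *)
Lemma n_comp_ltn x y :
  connect e2 x y -> ~~ connect e1 x y -> n_comp e2 predT < n_comp e1 predT.
Proof.
move=> xy nxy; set r := fun z => root e1 z.
have rootK z : roots e2 z -> root e2 (root e1 z) = z.
  move=> /eqP rz; rewrite -[RHS]rz; apply/esym/(rootP sym2)/sub12/connect_root.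
have inj : {in roots e2 &, injective r}.
  by move=> z t rz rt /(congr1 (root e2)); rewrite /r !rootK.
have eqr w : root e2 (root e1 w) = root e2 w.
  by apply/esym/(rootP sym2)/sub12/connect_root.
have [z rz nz] : exists2 z, z \in roots e1 & z \notin [set r t | t in roots e2].
  have [xi|] := boolP (root e1 x \in [set r t | t in roots e2]); last first.
    by exists (root e1 x) => //; apply: roots_root.
  exists (root e1 y); first exact: roots_root.
  apply: contra nxy => /imsetP[t rt yt]; case/imsetP: xi => t' rt' xt'.
  rewrite -(root_connect sym1) xt' yt.
  move: xy; rewrite -(root_connect sym2) -eqr xt' -(eqr y) yt /r !rootK //.
  by move=> /eqP->.
have card_n e : n_comp e predT = #|roots e|.
  by apply: eq_card => t; rewrite !inE andbT.
rewrite !card_n -(card_in_imset inj); apply: proper_card; apply/properP; split.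
  by apply/subsetP => _ /imsetP[t _ ->]; apply: roots_root.
by exists z.
Qed.

End Components.

(** * Minimal cuts and their directed versions *)

Section Cuts.
Variables (G : multigraph) (R : orientation G).
Implicit Types (d : arc G) (D : {set arc G}) (S C : subgraph G).
Implicit Types (X Y : {set vertex G}).

Notation head := (arc_head R).
Notation tail := (arc_tail R).

(** Taking both arcs of each edge makes undirected connectivity an instance of [reach]. *)
Definition arcs_of S : {set arc G} := [set d | d.1 \in S].

Lemma arcs_of_flip S d : (flip d \in arcs_of S) = (d \in arcs_of S).
Proof. by rewrite !inE. Qed.

Lemma set2_eq (T : finType) (a b c d : T) :
  ([set a; b] == [set c; d]) = (a == c) && (b == d) || (a == d) && (b == c).
Proof.
apply/eqP/orP => [E|[] /andP[/eqP-> /eqP->] //]; last by rewrite setUC.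
have : a \in [set c; d] by rewrite -E set21.
have : b \in [set c; d] by rewrite -E set22.
have : c \in [set a; b] by rewrite E set21.
have : d \in [set a; b] by rewrite E set22.
rewrite !inE; do 4![case/orP => /eqP ?]; subst; rewrite ?eqxx; by auto.
Qed.

Lemma adjacent_reach S : connect (adjacent S) =2 reach R (arcs_of S).
Proof.
apply: eq_connect => u v; apply/exists_inP/exists_inP => -[].
  move=> e eS; rewrite (ref_ends R) set2_eq; case/orP=> H.
    by exists (e, true); rewrite ?inE.
  by exists (e, false); rewrite ?inE // andbC.
move=> d; rewrite inE => dS /andP[/eqP tu /eqP hv]; exists d.1 => //.
by rewrite (ends_arc R) tu hv.
Qed.

Lemma reach_sym D u v : (forall d, (flip d \in D) = (d \in D)) ->
  reach R D u v = reach R D v u.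
Proof.
move=> flipD; suff imp x y : reach R D x y -> reach R D y x by apply/idP/idP; apply: imp.
move=> xy; have: y \in [set z | reach R D z x].
  apply: reach_closed xy; last by rewrite inE reach_refl.
  move=> d dD; rewrite !inE => tx; apply: reach_trans tx.
  by rewrite -[head d]tail_flip -[tail d]head_flip reach_arc ?flipD.
by rewrite inE.
Qed.

Lemma reach_arcs_sym S u v : reach R (arcs_of S) u v = reach R (arcs_of S) v u.
Proof. exact/reach_sym/arcs_of_flip. Qed.

Lemma arcs_ofS S S' : S \subset S' -> arcs_of S \subset arcs_of S'.
Proof. by move=> /subsetP sSS'; apply/subsetP=> d; rewrite !inE => /sSS'. Qed.

Lemma components_ltn S S' u v : S \subset S' ->
    reach R (arcs_of S') u v -> ~~ reach R (arcs_of S) u v ->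
  components S' < components S.
Proof.
move=> sSS' uv nuv; apply: (@n_comp_ltn _ _ _ _ _ _ u v); rewrite ?adjacent_reach //.
- by move=> x y; rewrite !adjacent_reach reach_arcs_sym.
- by move=> x y; rewrite !adjacent_reach reach_arcs_sym.
- by move=> x y; rewrite !adjacent_reach; apply/reach_mono/arcs_ofS.
Qed.

Lemma eq_components S S' : S \subset S' ->
    (forall d, d.1 \in S' -> reach R (arcs_of S) (tail d) (head d)) ->
  components S' = components S.
Proof.
move=> sSS' sub; apply: eq_n_comp => x y; rewrite !adjacent_reach.
apply/idP/idP; last by apply/reach_mono/arcs_ofS.
by apply: reach_sub => d; rewrite inE => /sub.
Qed.

Lemma in_out_arcs X d : (d \in out_arcs R X) = (tail d \in X) && (head d \notin X).
Proof. by rewrite inE. Qed.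

Lemma joiningP X d :
  (d.1 \in joining X) = (d \in out_arcs R X) || (flip d \in out_arcs R X).
Proof.
rewrite !inE tail_flip head_flip (ends_arc R).
have E Y : [set tail d; head d] :&: Y != set0 = (tail d \in Y) || (head d \in Y).
  apply/set0Pn/orP => [[x]|[] dY]; rewrite ?inE.
  - by case/andP=> /orP[] /eqP->; auto.
  - by exists (tail d); rewrite !inE eqxx.
  - by exists (head d); rewrite !inE eqxx orbT.
by rewrite !E !inE; case: (_ \in X) (_ \in X) => [] [].
Qed.

Lemma underlying_out X : underlying (out_arcs R X) = joining X.
Proof.
apply/setP=> e; apply/imsetP/idP => [[d dX ->]|]; first by rewrite joiningP dX.
by rewrite -[e]/((e, true).1) joiningP => /orP[] ?; eexists; eauto.
Qed.

Lemma joining_crossed X d : d.1 \in joining X -> (tail d \in X) != (head d \in X).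
Proof.
rewrite joiningP !inE tail_flip head_flip.
by case: (_ \in X) (_ \in X) => [] [].
Qed.

Lemma uncrossed X u v : reach R (arcs_of (~: joining X)) u v -> (u \in X) = (v \in X).
Proof.
suff imp x y : x \in X -> reach R (arcs_of (~: joining X)) x y -> y \in X.
  move=> uv; apply/idP/idP => /imp; apply=> //.
  by rewrite reach_arcs_sym.
move=> xX; apply: reach_closed xX => d; rewrite inE in_setC joiningP !in_out_arcs.
by rewrite negb_or negb_and negbK => /andP[/orP[/negP|] //].
Qed.

Lemma disconnecting_joining X d : d.1 \in joining X -> disconnecting (joining X).
Proof.
move=> dX; apply/andP; split; first by apply/set0Pn; exists d.1.
apply: (components_ltn (u := tail d) (v := head d)); first exact: subsetT.
  by apply: reach_arc; rewrite !inE.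
by apply: contra (joining_crossed dX) => /uncrossed->.
Qed.

(* The side of the bond not containing [tail d] is the component [W] of [head d]
   left by removing the boundary of the component [K] of [tail d]. *)
Lemma bond_through X d : d \in out_arcs R X ->
  exists Y, [/\ is_cut (joining Y), d \in out_arcs R Y
              & out_arcs R Y \subset out_arcs R X].
Proof.
rewrite inE => /andP[tX hX].
pose K := [set v | reach R (arcs_of (~: joining X)) (tail d) v].
pose W := [set v | reach R (arcs_of (~: joining K)) (head d) v].
have sKX v : v \in K -> v \in X by rewrite inE => /uncrossed <-.
have tK : tail d \in K by rewrite inE reach_refl.
have hK : head d \notin K by apply: contra hX => /sKX.
have WK v : v \in W -> v \notin K by rewrite inE => /uncrossed <-.
have outK : out_arcs R K \subset out_arcs R X.
  apply/subsetP => d'; rewrite !in_out_arcs => /andP[tK' hK'].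
  have tX' := sKX _ tK'; rewrite tX' /=; apply: contra hK' => hX'.
  move: tK'; rewrite !inE => /reach_trans; apply; apply: reach_arc.
  by rewrite inE in_setC joiningP !in_out_arcs tail_flip head_flip tX' hX'.
have outY : out_arcs R (~: W) \subset out_arcs R K.
  apply/subsetP => d'; rewrite !in_out_arcs !in_setC negbK => /andP[tW hW].
  have hK' := WK _ hW; rewrite hK' andbT; apply: contraR tW => tK'.
  rewrite inE in hW; rewrite inE; apply: reach_trans hW _.
  rewrite -[head d']tail_flip -[tail d']head_flip reach_arc // arcs_of_flip inE.
  rewrite in_setC joiningP !in_out_arcs.
  by rewrite tail_flip head_flip (negPf hK') (negPf tK').
exists (~: W); rewrite (subset_trans outY outK); split=> //; last first.
  by rewrite inE !in_setC negbK (contraL (WK _) tK) inE reach_refl.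
have dY : d.1 \in joining (~: W).
  by rewrite joiningP inE !in_setC negbK (contraL (WK _) tK) [_ \in W]inE reach_refl.
apply/minsetP; split; first exact: disconnecting_joining dY.
move=> C /andP[C0 ltC] sC; apply/eqP; rewrite eqEsubset sC /=.
apply/subsetP => e eY; apply/negPn/negP => eC.
(* Without [C], the tails of the crossing arcs are still connected to [tail d] and their heads to
   [head d]. The surviving edge [e] joins the two groups, so the ends of every deleted edge remain
   connected. *)
suff E : components [set: edge G] = components (~: C) by rewrite E ltnn in ltC.
apply: eq_components (subsetT _) _ => d' _.
have subj (Z : {set vertex G}) : out_arcs R (~: W) \subset out_arcs R Z ->
    arcs_of (~: joining Z) \subset arcs_of (~: C).
  move=> sZ; apply: arcs_ofS; rewrite setCS (subset_trans sC) //.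
  by rewrite -!underlying_out imsetS.
have near d2 : d2 \in out_arcs R (~: W) ->
    reach R (arcs_of (~: C)) (tail d) (tail d2) /\
    reach R (arcs_of (~: C)) (head d) (head d2).
  move=> d2Y; split; [apply: (@reach_mono _ _ (arcs_of (~: joining X))) |
    apply: (@reach_mono _ _ (arcs_of (~: joining K)))].
  - exact: subj (subset_trans outY outK).
  - by have := subsetP outY _ d2Y; rewrite in_out_arcs !inE => /andP[].
  - exact: subj.
  - by move: d2Y; rewrite in_out_arcs !in_setC negbK !inE => /andP[].
have [d2 d2Y d2C] : exists2 d2, d2 \in out_arcs R (~: W) & d2 \in arcs_of (~: C).
  move: eY; rewrite -[e]/((e, true).1) joiningP => /orP[] eY.
    by exists (e, true); rewrite // inE in_setC.
  by exists (flip (e, true)); rewrite // inE in_setC.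
have td : reach R (arcs_of (~: C)) (tail d) (head d).
  have [t2 h2] := near _ d2Y; apply: reach_trans t2 (reach_trans (reach_arc _ d2C) _).
  by rewrite reach_arcs_sym.
have [d'C|d'C] := boolP (d'.1 \in C); last first.
  by apply: reach_arc; rewrite !inE.
have across d3 : d3 \in out_arcs R (~: W) ->
    reach R (arcs_of (~: C)) (tail d3) (head d3).
  move=> /near[t3 h3]; apply: reach_trans (reach_trans td h3).
  by rewrite reach_arcs_sym.
have := subsetP sC _ d'C; rewrite joiningP => /orP[/across //|/across].
by rewrite tail_flip head_flip reach_arcs_sym.
Qed.

(** Otherwise putting [d.1] back would not change the number of components, so [C :\ d.1] would
    disconnect as well, against minimality, or be empty, and then [C] would not disconnect. *)
Lemma cut_separates C d : is_cut C -> d.1 \in C ->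
  ~~ reach R (arcs_of (~: C)) (tail d) (head d).
Proof.
case/minsetP=> /andP[_ ltC] minC dC; apply/negP => td.
have E : components (~: (C :\ d.1)) = components (~: C).
  apply: eq_components => [|d']; first by rewrite setCS subsetDl.
  rewrite !inE negb_and negbK => /orP[/eqP|d'C]; last by apply: reach_arc; rewrite !inE.
  by move=> /same_edge[->//|->]; rewrite tail_flip head_flip reach_arcs_sym.
have [C0|C0] := eqVneq (C :\ d.1) set0.
  by move: ltC; rewrite -E C0 setC0 ltnn.
have := minC (C :\ d.1); rewrite /disconnecting C0 E ltC subsetDl => /(_ isT isT).
by move/setP/(_ d.1); rewrite !inE dC eqxx.
Qed.

(** Let [X] be the component of one end of an edge of [C] after deleting [C]. The boundary of [X] is
    disconnecting and lies in [C], hence equals [C] by minimality. *)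
Lemma cut_dicut C : is_cut C <-> exists2 D, is_dicut R D & underlying D = C.
Proof.
split=> [cutC|[_ /existsP[X /andP[cX /eqP->]] <-]]; last by rewrite underlying_out.
have [/andP[/set0Pn[e eC] _] minC] := minsetP cutC.
have sep := @cut_separates C (e, true) cutC eC.
pose X := [set v | reach R (arcs_of (~: C)) (tail (e, true)) v].
have sXC : joining X \subset C.
  have sub d : d \in out_arcs R X -> d.1 \in C.
    rewrite !inE => /andP[tX]; apply: contraR => dC.
    by apply: reach_trans tX (reach_arc _ _); rewrite !inE.
  apply/subsetP => f; rewrite -[f]/((f, true).1) joiningP.
  by case/orP=> /sub.
have eX : (e, true).1 \in joining X by rewrite joiningP !inE reach_refl sep.
have XC := minC _ (disconnecting_joining eX) sXC.
exists (out_arcs R X); last by rewrite underlying_out XC.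
by apply/existsP; exists X; rewrite XC cutC eqxx.
Qed.

End Cuts.

(** * Activities as reachability queries *)

Section Activity.
Variables (G : multigraph) (R : orientation G) (lt : rel (edge G)).
Variable lt_order : strict_total_order lt.
Implicit Types (d : arc G) (H O : {set arc G}) (S C : subgraph G) (k : bool).

Notation head := (arc_head R).
Notation tail := (arc_tail R).

Lemma lt_irr : irreflexive lt. Proof. by case: lt_order. Qed.

Lemma lt_tr : transitive lt. Proof. by case: lt_order. Qed.

Lemma lt_total e f : e != f -> lt e f || lt f e.
Proof. by case: lt_order => _ _; apply. Qed.

Lemma lt_neq e f : lt e f -> e != f.
Proof. by apply: contraTneq => ->; rewrite lt_irr. Qed.

Lemma lt_asym e f : lt e f -> ~~ lt f e.
Proof. by move=> ef; apply/negP => /(lt_tr ef); rewrite lt_irr. Qed.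

Lemma min_edgeP e C :
  reflect (e \in C /\ forall f, f \in C -> ~~ lt f e) (min_edge lt e C).
Proof.
apply: (iffP andP) => -[eC minC]; split=> //; last first.
  apply/forall_inP => f fC; apply/implyP => fe.
  by have := lt_total fe; rewrite (negPf (minC f fC)).
move=> f fC; have [->|fe] := eqVneq f e; first by rewrite lt_irr.
by apply: lt_asym; move/forall_inP: minC => /(_ f fC)/implyP/(_ fe).
Qed.

(* Edges below [d] are contracted when looking for a cut with minimum [d.1]
   ([k = true]) and deleted when looking for a cycle ([k = false]). *)
Definition base k d H : {set arc G} :=
  [set d' | k && lt d'.1 d.1 || lt d.1 d'.1 && (d' \in H)].

(** The two kinds have opposite polarity: a return walk witnesses a potential cycle but obstructs a
    potential cut. *)
Definition returns k d H := reach R (base k d H) (head d) (tail d).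

Lemma min_in_potential_cutP O e :
  reflect (exists b, flip (e, b) \notin O /\ ~~ returns true (e, b) O)
          (min_in_potential_cut lt R O e).
Proof.
apply: (iffP existsP) => [[D /andP[/andP[/existsP[X]]]]|[b [fO nret]]].
  case/andP=> cX /eqP-> /forall_inP OD /min_edgeP[/imsetP[d dX ->] minX].
  exists d.2; rewrite -surjective_pairing; split; first exact: OD.
  move: (dX); rewrite in_out_arcs => /andP[tX]; rewrite -in_setC => hX.
  apply: contraL tX => ret; rewrite -in_setC; apply: reach_closed ret => // d'.
  rewrite inE /= !in_setC => d'B tX'; apply/negP => hX'.
  have fX : flip d' \in out_arcs R X.
    by rewrite in_out_arcs tail_flip head_flip hX'.
  case/orP: d'B => [d'd|/andP[_ d'O]].
    by have := minX _ (imset_f _ fX); rewrite /= d'd.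
  by have := OD _ fX; rewrite -/(flip (flip d')) flipK d'O.
(* No arc of the base enters [X]. As both arcs of each smaller edge are in the base, no smaller edge
   crosses the boundary of [X]. That boundary need not be minimal, so [bond_through] extracts a cut
   from it. *)
pose X := ~: [set v | reach R (base true (e, b) O) (head (e, b)) v].
have dX : (e, b) \in out_arcs R X by rewrite in_out_arcs !inE nret reach_refl.
have [Y [cY dY sYX]] := bond_through dX.
have crossX d : d \in out_arcs R Y -> flip d \notin base true (e, b) O.
  move/(subsetP sYX); rewrite in_out_arcs !inE negbK => /andP[tX hX].
  apply: contra tX => fB; apply: reach_trans hX _.
  by rewrite -tail_flip -[tail d]head_flip reach_arc ?inE.
exists (out_arcs R Y); apply/andP; split; [apply/andP; split|].
- by apply/existsP; exists Y; rewrite cY eqxx.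
- apply/forall_inP => d dY'; have := crossX _ dY'; rewrite inE /= negb_or.
  case/andP=> nlt; rewrite negb_and => /orP[ngt|//].
  have : d.1 == e.
    by apply: contraNT ngt => /lt_total; rewrite (negPf nlt).
  move=> /eqP/(@same_edge _ (e, b))[->//|dd].
  have := subsetP sYX _ dY'; rewrite dd in_out_arcs tail_flip.
  by rewrite !inE reach_refl.
- apply/min_edgeP; split; first by apply/imsetP; exists (e, b).
  move=> _ /imsetP[d dY' ->]; have := crossX _ dY'.
  by rewrite inE /= negb_or => /andP[].
Qed.

Lemma min_in_potential_cycleP O e :
  reflect (exists b, (e, b) \in O /\ returns false (e, b) O)
          (min_in_potential_cycle lt R O e).
Proof.
have baseE b d' : d' \in base false (e, b) O -> d'.1 != e.
  by rewrite inE /= => /andP[/lt_neq]; rewrite eq_sym.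
apply: (iffP existsP) => [[D /andP[/andP[cD /subsetP sDO]]]|[b [dO]]].
  case/min_edgeP=> /imsetP[d dD ->] minD; exists d.2.
  rewrite -surjective_pairing; split; first exact: sDO.
  have := reach_of_dicycle cD dD; apply: reach_mono.
  apply/subsetP => d'; rewrite !inE => /andP[d'D /lt_total].
  by rewrite (negPf (minD _ (imset_f _ d'D))) /= sDO ?andbT.
case/dicycle_of_reach => [d' /baseE //|C cC /andP[dC /subsetP sC]].
exists C; apply/andP; split.
  rewrite /potential_cycle cC; apply/subsetP => d' /sC/setU1P[->//|].
  by rewrite inE /= => /andP[].
apply/min_edgeP; split; first by apply/imsetP; exists (e, b).
move=> _ /imsetP[d' /sC/setU1P[->|d'B] ->]; first by rewrite lt_irr.
by move: d'B; rewrite inE /= => /andP[/lt_asym].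
Qed.

Lemma returns_arcs_of k S d : returns k (flip d) (arcs_of S) = returns k d (arcs_of S).
Proof. by rewrite /returns tail_flip head_flip reach_sym // => d'; rewrite !inE. Qed.

Lemma base_eq k d H H' : (forall d', lt d.1 d'.1 -> (d' \in H) = (d' \in H')) ->
  base k d H = base k d H'.
Proof.
by move=> E; apply/setP=> d'; rewrite !inE; case: (boolP (lt d.1 _)) => // /E->.
Qed.

(** A cut avoiding [S :\ d.1] is a potential cut of the fourientation that biorients [S :\ d.1] and
    unorients all other edges. Its base at [d] sees no arc of [d.1], so [S] may replace
    [S :\ d.1]. *)
Lemma mem_Ihat S d : (d.1 \in Ihat lt S) = ~~ returns true d (arcs_of S).
Proof.
have baseE b : base true (d.1, b) (arcs_of (S :\ d.1)) = base true d (arcs_of S).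
  by apply: base_eq => d' /lt_neq d'd; rewrite !inE eq_sym d'd.
have retE b : returns true (d.1, b) (arcs_of (S :\ d.1)) = returns true d (arcs_of S).
  rewrite /returns baseE; have [->|->] := @same_edge _ d (d.1, b) erefl => //.
  exact: returns_arcs_of.
transitivity (min_in_potential_cut lt R (arcs_of (S :\ d.1)) d.1); last first.
  apply/min_in_potential_cutP/idP => [[b [_]]|nret]; first by rewrite retE.
  by exists d.2; rewrite retE !inE eqxx.
rewrite inE; apply/existsP/existsP => [[C /and3P[cC dis minC]]|[D]].
  have [D cD DC] := (cut_dicut R C).1 cC; exists D.
  rewrite /potential_cut cD DC minC andbT; apply/forall_inP => d' d'D.
  rewrite inE; apply/negbT/(disjointFr dis); rewrite -DC.
  by apply/imsetP; exists d'.
case/andP=> /andP[cD /forall_inP DS] minD; exists (underlying D).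
rewrite minD andbT; apply/andP; split; first by apply/(cut_dicut R); exists D.
rewrite disjoint_subset; apply/subsetP => _ /imsetP[d' d'D ->].
by have := DS _ d'D; rewrite !inE.
Qed.

Lemma mem_Lhat S d : (d.1 \in Lhat lt S) = returns false d (arcs_of S).
Proof.
have baseE b : base false (d.1, b) (arcs_of (d.1 |: S)) = base false d (arcs_of S).
  by apply: base_eq => d' /lt_neq d'd; rewrite !inE eq_sym (negPf d'd).
have retE b : returns false (d.1, b) (arcs_of (d.1 |: S)) = returns false d (arcs_of S).
  rewrite /returns baseE; have [->|->] := @same_edge _ d (d.1, b) erefl => //.
  exact: returns_arcs_of.
transitivity (min_in_potential_cycle lt R (arcs_of (d.1 |: S)) d.1); last first.
  apply/min_in_potential_cycleP/idP => [[b [_]]|ret]; first by rewrite retE.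
  by exists d.2; rewrite retE !inE eqxx.
rewrite inE; apply/existsP/existsP => [[C /and3P[cC /subsetP sC minC]]|[D]].
  have [D cD DC] := (cycle_dicycle R C).1 cC; exists D.
  rewrite /potential_cycle cD DC minC andbT; apply/subsetP => d' d'D.
  by rewrite inE sC // -DC; apply/imsetP; exists d'.
case/andP=> /andP[cD /subsetP DS] minD; exists (underlying D).
rewrite minD andbT; apply/andP; split; first by apply/(cycle_dicycle R); exists D.
by apply/subsetP => _ /imsetP[d' d'D ->]; have := DS _ d'D; rewrite !inE.
Qed.

(** * Queries and the elimination argument *)

Variables sigma_u sigma_b : edge G -> sign.

(* The arcs [d] whose [returns k d] must survive the settling of larger edges. *)
Definition query k d H : bool :=
  if k then (flip d \notin H) && ((d \in H) || (d.2 == sigma_u d.1))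
  else (d \in H) && ((flip d \notin H) || (d.2 == ~~ sigma_b d.1)).

(** On an oriented edge only its arc in [H] qualifies; where both directions could, the sign label
    selects one. *)
Lemma query_unique k d d' H : d'.1 = d.1 -> query k d H -> query k d' H -> d' = d.
Proof.
move=> /same_edge[//|->]; rewrite /query flipK /=.
case: k; case: (d \in H) (flip d \in H) => [] [] //=.
all: by move=> /eqP<-; case: d.2.
Qed.

Lemma baseU k d d0 H : lt d.1 d0.1 -> base k d (d0 |: H) = d0 |: base k d H.
Proof.
move=> dd0; apply/setP=> d'; rewrite !inE.
by case: eqP => [->|_] //=; rewrite dd0 orbT.
Qed.

Lemma returns_flipI k d d0 H : lt d.1 d0.1 ->
  returns k d (d0 |: H) && returns k d (flip d0 |: H) = returns k d H.
Proof. by move=> lt0; rewrite /returns !baseU // reach_flipI. Qed.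

Lemma returns_flipU k d d0 H : lt d.1 d0.1 ->
  returns k d (d0 |: (flip d0 |: H)) =
    returns k d (d0 |: H) || returns k d (flip d0 |: H).
Proof. by move=> lt0; rewrite /returns !baseU // reach_flipU. Qed.

(** For [d0] equal to [e^+] this is the condition [r+ -> r-] on all queries of smaller edges. *)
Definition redundant d0 H : bool :=
  [forall q : bool * arc G, [&& lt q.2.1 d0.1, query q.1 q.2 H
    & returns q.1 q.2 (d0 |: H)] ==> returns q.1 q.2 (flip d0 |: H)].

Lemma redundantP d0 H k d : redundant d0 H -> lt d.1 d0.1 -> query k d H ->
  returns k d (d0 |: H) -> returns k d (flip d0 |: H).
Proof. by move=> /forallP/(_ (k, d))/implyP /= imp *; apply: imp; apply/and3P. Qed.

(** The query fails but would succeed with one more arc from [a] to [b]. In terms of vertices,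
    reversing that arc just exchanges [a] and [b]. *)
Definition blocked k d H (a b : vertex G) : Prop :=
  [/\ query k d H, ~ reach R (base k d H) (head d) (tail d),
      reach R (base k d H) (head d) a & reach R (base k d H) b (tail d)].

Lemma not_redundant d0 H : ~~ redundant d0 H ->
  exists k d, lt d.1 d0.1 /\ blocked k d H (tail d0) (head d0).
Proof.
case/forallPn=> -[k d]; rewrite negb_imply /= => /andP[/and3P[lt0 qd]].
rewrite /returns !baseU // => /reach_addP H1 /reach_addP H2.
exists k, d; split=> //; case: H1 => [H1|[ha bt]]; first by case: H2; left.
by split=> // /or_introl/H2.
Qed.

(** For cuts, the smaller arc [d] is contracted in the query of [d'], which gives a walk from [b]
    through [d] to [a]. For cycles, the larger arc [d'] is available to the query of [d] and links
    [a] to [b]. Either way a failing query succeeds. *)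
Lemma clash_lt k d d' H a b : lt d.1 d'.1 ->
  blocked k d H a b -> blocked k d' H b a -> False.
Proof.
move=> lt_dd [qd no ha bt] [qd' no' hb av].
case: k qd no ha bt qd' no' hb av => qd no ha bt qd' no' hb av.
  case/andP: qd' => nfd' _.
  have sB : base true d H \subset d' |: base true d' H.
    apply/subsetP => g; rewrite !inE /=.
    case/orP=> [gd|/andP[_ gH]]; first by rewrite (lt_tr gd lt_dd) orbT.
    have [/eqP/same_edge[->|gd]|gd'] := boolP (g.1 == d'.1); first by rewrite eqxx.
      by rewrite -gd gH in nfd'.
    by rewrite gH andbT lt_total // orbT.
  have dB : d \in d' |: base true d' H by rewrite !inE /= lt_dd orbT.
  have : reach R (d' |: base true d' H) b a.
    apply: reach_trans (reach_mono sB bt) (reach_trans (reach_arc _ dB) (reach_mono sB ha)).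
  (* A walk using [d'] has already reached [tail d'], the target of the query. *)
  case/reach_addP=> [ba|[bt' _]]; apply: no'; first exact: reach_trans hb (reach_trans ba av).
  exact: reach_trans hb bt'.
case/andP: qd' => d'H _; apply: no.
have sB : base false d' H \subset base false d H.
  by apply/subsetP => g; rewrite !inE /= => /andP[/(lt_tr lt_dd)->].
have dB : d' \in base false d H by rewrite !inE /= lt_dd.
apply: reach_trans ha (reach_trans (reach_mono sB av) _).
exact: reach_trans (reach_arc _ dB) (reach_trans (reach_mono sB hb) bt).
Qed.

Lemma clash_same k d d' H a b :
  blocked k d H a b -> blocked k d' H b a -> False.
Proof.
move=> bd bd'; have [dd'|ne] := eqVneq d.1 d'.1; last first.
  by case/orP: (lt_total ne) => /clash_lt; [apply; eauto | apply; eauto].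
case: bd bd' => qd no ha bt [qd' _ hb _].
have E := query_unique dd' qd' qd; rewrite {}E in no ha bt.
by apply: no; apply: reach_trans hb bt.
Qed.

(** The cycle query yields a walk from [a] through [d'] to [b] along arcs of [H]. Since [flip d] is
    not in [H], the cut query of [d] can follow it, stopping at [tail d] should it use [d]. *)
Lemma clash_mixed d d' H a b :
  blocked true d H a b -> blocked false d' H b a -> False.
Proof.
move=> [/andP[nfd _] no ha bt] [/andP[d'H _] _ hb av].
have sB (d1 : arc G) : base false d1 H \subset d |: base true d H.
  apply/subsetP => g; rewrite !inE /= => /andP[_ gH]; rewrite gH andbT.
  have [/eqP/same_edge[->|gd]|gd'] := boolP (g.1 == d.1); first by rewrite eqxx.
    by rewrite -gd gH in nfd.
  by rewrite lt_total // orbT.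
have dB : d' \in d |: base true d H.
  rewrite !inE d'H andbT /=.
  have [/eqP/same_edge[->|gd]|gd'] := boolP (d'.1 == d.1); first by rewrite eqxx.
    by rewrite -gd d'H in nfd.
  by rewrite lt_total // orbT.
have: reach R (d |: base true d H) a b.
  apply: reach_trans (reach_mono (sB _) av) _.
  exact: reach_trans (reach_arc _ dB) (reach_mono (sB _) hb).
case/reach_addP=> [ab|[aw _]]; apply: no; last exact: reach_trans ha aw.
exact: reach_trans ha (reach_trans ab bt).
Qed.

Lemma redundant_or d0 H : redundant d0 H || redundant (flip d0) H.
Proof.
apply/norP => -[/not_redundant[k [d [_ bd]]] /not_redundant[k' [d' [_ bd']]]].
rewrite tail_flip head_flip in bd'.
case: k k' bd bd' => [] [].
- exact: clash_same.
- exact: clash_mixed.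
- by move=> bd bd'; apply: clash_mixed bd' bd.
- exact: clash_same.
Qed.

(** * Settling one edge *)

Definition others e H : {set arc G} := [set d in H | d.1 != e].

(* Settling [e] means biorienting it exactly when this is its sign.  The clause
   on [returns] makes the right choice for (d) when both choices are harmless:
   there it holds when [e] has become a bridge and fails when it has become a loop. *)
Definition kept_sign e H : bool :=
  redundant (e, false) H && (~~ redundant (e, true) H || ~~ returns false (e, true) H).

Definition settle e H : {set arc G} :=
  [set d | if (d.1 == e) && (e \in oriented H)
           then ((e, true) \in H) == kept_sign e (others e H) else d \in H].

Lemma mem_settle d e H : (d \in settle e H) =
  if (d.1 == e) && (e \in oriented H)
  then ((e, true) \in H) == kept_sign e (others e H) else d \in H.
Proof. by rewrite inE. Qed.

Lemma oriented_arcE d H : (d.1 \in oriented H) = (d \in H) (+) (flip d \in H).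
Proof.
case: d => e []; rewrite !inE /flip /=;
by case: ((e, true) \in H) ((e, false) \in H) => [] [].
Qed.

Lemma mem_settle_neq e H d : d.1 != e -> (d \in settle e H) = (d \in H).
Proof. by rewrite mem_settle => /negPf->. Qed.

Lemma oriented_arc e O : e \in oriented O ->
  exists d, [/\ d.1 = e, d \in O & flip d \notin O].
Proof.
rewrite -[e \in _]/((e, true).1 \in _) oriented_arcE.
case: (boolP (_ \in O)) => [tO fO|tO fO]; first by exists (e, true).
by exists (flip (e, true)); rewrite flipK.
Qed.

Lemma oriented_settle e H : oriented (settle e H) = oriented H :\ e.
Proof.
apply/setP=> f; rewrite -[f]/((f, true).1) oriented_arcE in_setD1.
have [->|ne] := eqVneq f e; last by rewrite !mem_settle_neq // -(oriented_arcE (f, true)).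
rewrite !mem_settle !eqxx /=; case: ifP => [_|]; first by rewrite addbb.
by rewrite -[e \in _]/((e, true).1 \in _) oriented_arcE.
Qed.

Lemma settle_arc d H : d \in H -> flip d \notin H -> let K := others d.1 H in
  settle d.1 H = if d.2 == kept_sign d.1 K then d |: (flip d |: K) else K.
Proof.
move=> dH fH K; have od : d.1 \in oriented H by rewrite oriented_arcE dH (negPf fH).
have d2 : ((d.1, true) \in H) = d.2.
  by case: d dH fH {K od} => e [] dH fH //=; apply: negPf.
apply/setP=> d'; rewrite mem_settle od andbT d2 (fun_if (fun D : {set arc G} => d' \in D)).
rewrite !inE; have [/same_edge dd|ne] := eqVneq d'.1 d.1.
  by case: dd => ->; rewrite eqxx ?orbT andbF; case: ifP.
have [dd|_] := eqVneq d' d; first by rewrite dd eqxx in ne.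
have [dd|_] := eqVneq d' (flip d); first by rewrite dd eqxx in ne.
by rewrite andbT if_same.
Qed.

Lemma others_arc d H : d \in H -> flip d \notin H -> H = d |: others d.1 H.
Proof.
move=> dH fH; apply/setP=> d'; rewrite !inE; have [->|ne] := eqVneq d' d => //=.
case: eqVneq => [/same_edge[/eqP|->]|_]; rewrite ?andbT ?andbF ?(negPf ne) //.
exact: negPf.
Qed.

Lemma query_others k d e H : d.1 != e -> query k d (others e H) = query k d H.
Proof. by move=> ne; rewrite /query !inE /= ne !andbT. Qed.

Lemma query_settle k d e H : d.1 != e -> query k d (settle e H) = query k d H.
Proof. by move=> ne; rewrite /query !mem_settle_neq. Qed.

(** Biorienting adds [flip d], which is harmless when [flip d] is redundant; unorienting removes
    [d], which is harmless when [d] is. By [redundant_or], the sign chosen always falls in the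
    harmless case. *)
Lemma redundant_kept d H :
  redundant (if d.2 == kept_sign d.1 H then flip d else d) H.
Proof.
case: d => e b; have := redundant_or (e, true) H; rewrite /kept_sign /flip /=.
case Et: (redundant (e, true) H); case Ef: (redundant (e, false) H) => //= _.
all: by case: ifP; case: b => //=; rewrite ?Et ?Ef // => /eqP.
Qed.

Lemma base_settle k d e H : ~~ lt d.1 e -> base k d (settle e H) = base k d H.
Proof.
move=> nlt; apply: base_eq => d' lt'; apply: mem_settle_neq.
by apply: contra nlt => /eqP <-.
Qed.

(** If [d.1] is smaller than [e], the answer becomes the disjunction or the conjunction of those for
    the two orientations of [e], and redundancy reduces it to the old one. Otherwise the base does
    not see [e]. *)
Lemma returns_settle k d e H : query k d H ->
  returns k d (settle e H) = returns k d H.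
Proof.
move=> qd; have [lte|nlt] := boolP (lt d.1 e); last by rewrite /returns base_settle.
have [oe|ne] := boolP (e \in oriented H); last first.
  congr returns; apply/setP=> d'; by rewrite mem_settle (negPf ne) andbF.
have [d0 [e0 d0H fH]] := oriented_arc oe.
rewrite -{}e0 in lte *; set K := others d0.1 H.
have qK : query k d K by rewrite query_others // lt_neq.
rewrite settle_arc // -/K {1}(others_arc d0H fH) -/K.
have := redundant_kept d0 K; case: ifP => _ red.
  rewrite returns_flipU //; apply/orb_idr.
  by have := redundantP red lte qK; rewrite flipK.
rewrite -(returns_flipI k K lte); apply/andb_idr.
exact: redundantP red lte qK.
Qed.

(** * Settling the edges in decreasing order *)

Definition settle_all (s : seq (edge G)) H := foldl (fun H e => settle e H) H s.

Lemma base_settle_all k d s H : all (fun e => ~~ lt d.1 e) s ->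
  base k d (settle_all s H) = base k d H.
Proof. by elim: s H => //= e s IH H /andP[nlt /IH->]; apply: base_settle. Qed.

Lemma mem_settle_all s H d : d.1 \notin s -> (d \in settle_all s H) = (d \in H).
Proof.
by elim: s H => //= e s IH H; rewrite inE negb_or => /andP[ne /IH->]; rewrite mem_settle_neq.
Qed.

Lemma oriented_settle_all s H :
  oriented (settle_all s H) = oriented H :\: [set e in s].
Proof.
elim: s H => [|e s IH] H /=; first by apply/setP=> f; rewrite !inE.
rewrite IH oriented_settle; apply/setP=> f; rewrite in_setD in_setD1 [RHS]in_setD !inE.
by rewrite negb_or; case: eqP => //=; case: (f \in s).
Qed.

(** The kept sign depends only on [others e H], which settling preserves; so whether [e] came out
    bioriented reveals its former direction. *)
Lemma settle_inj e H H' : oriented H = oriented H' ->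
  settle e H = settle e H' -> H = H'.
Proof.
move=> oHH' /setP sHH'; have ne d : d.1 != e -> (d \in H) = (d \in H').
  by move=> de; have := sHH' d; rewrite !mem_settle_neq.
have oth : others e H = others e H'.
  by apply/setP=> d; rewrite !inE; have [//|de] := eqVneq d.1 e; rewrite ?andbF // ne.
have [oe|noe] := boolP (e \in oriented H); last first.
  apply/setP=> d; have := sHH' d; rewrite !mem_settle -oHH'.
  by rewrite (negPf noe) andbF.
have tE : ((e, true) \in H) = ((e, true) \in H').
  have := sHH' (e, true); rewrite !mem_settle -oHH' eqxx oe oth /=.
  by case: (_ \in H) (_ \in H') (kept_sign _ _) => [] [] [].
have fE : ((e, false) \in H) = ((e, false) \in H').
  have := oriented_arcE (e, true) H'; have := oriented_arcE (e, true) H.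
  rewrite /flip /= -oHH' oe tE.
  by case: ((e, true) \in H') ((e, false) \in H) ((e, false) \in H') => [] [] [].
apply/setP=> -[f b]; have [->|fe] := eqVneq f e; last exact: ne.
by case: b.
Qed.

Lemma settle_all_inj s H H' : oriented H = oriented H' ->
  settle_all s H = settle_all s H' -> H = H'.
Proof.
elim: s H H' => //= e s IH H H' oH /IH E; apply: (settle_inj oH); apply: E.
by rewrite !oriented_settle oH.
Qed.

(** Once [d.1] is settled, [d] may cease to be a query, but then only smaller edges remain and they
    leave its base unchanged. *)
Lemma returns_settle_all k d s H : pairwise (fun e f => lt f e) s ->
  query k d H -> returns k d (settle_all s H) = returns k d H.
Proof.
elim: s H => //= e s IH H /andP[/allP ltes desc] qd.
rewrite -(returns_settle e qd); have [de|ne] := eqVneq d.1 e.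
  rewrite /returns base_settle_all //; apply/allP => f /ltes fe.
  by rewrite de lt_asym.
by apply: IH => //; rewrite query_settle.
Qed.

(** [K] is the state in which the fate of [d.1] is decided, without the arcs of that edge. Larger
    edges are final by then, so the decision can be analysed on the final base. *)
Lemma settle_all_at s H d : pairwise (fun e f => lt f e) s -> d.1 \in s ->
    d \in H -> flip d \notin H ->
  exists K : {set arc G}, [/\ forall b, (d.1, b) \notin K,
    forall k, base k d (settle_all s H) = base k d K
    & (d \in settle_all s H) = (d.2 == kept_sign d.1 K)].
Proof.
elim: s H => //= e s IH H /andP[/allP ltes desc]; rewrite inE.
have [de _|ne /= ds] := eqVneq d.1 e; last first.
  by move=> dH fH; apply: IH; rewrite ?mem_settle_neq.
rewrite -{}de in ltes * => dH fH; exists (others d.1 H).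
have ds : d.1 \notin s by apply/negP => /ltes; rewrite lt_irr.
split=> [b|k|]; first by rewrite !inE eqxx andbF.
  rewrite base_settle_all; last by apply/allP => f /ltes /lt_asym.
  rewrite base_settle ?lt_irr //; apply: base_eq => d' /lt_neq.
  by rewrite !inE eq_sym => ->; rewrite andbT.
rewrite mem_settle_all // settle_arc //; case: ifP => _; first exact: setU11.
by rewrite !inE eqxx andbF.
Qed.

(** A smaller query blocked for want of [(e, false)] would give, through its own contracted arc, a
    return walk for [(e, false)]. *)
Lemma kept_sign_bridge e H : (forall b, (e, b) \notin H) ->
  (forall b, ~~ returns true (e, b) H) -> kept_sign e H.
Proof.
move=> eH nret; apply/andP; split; last first.
  apply/orP; right; apply: contra (nret true); apply: reach_mono.
  by apply/subsetP=> d; rewrite !inE /= => ->; rewrite orbT.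
apply/negPn/negP => /not_redundant[k [d [lte [_ _ ha bt]]]].
have sB : base k d H \subset base true (e, false) H.
  apply/subsetP=> g; rewrite !inE /= => /orP[/andP[_ /lt_tr->] //|/andP[_ gH]].
  rewrite gH andbT orbC lt_total //; apply: contraTneq gH => E.
  by have := eH g.2; rewrite E -surjective_pairing.
have dB : d \in base true (e, false) H by rewrite !inE /= lte.
case/negP: (nret false); apply: reach_trans (reach_mono sB bt) _.
exact: reach_trans (reach_arc _ dB) (reach_mono sB ha).
Qed.

(** A walk of larger arcs parallel to [(e, true)] replaces this arc in every smaller query, so
    [(e, true)] is redundant. *)
Lemma kept_sign_loop e H : (forall b, returns false (e, b) H) -> ~~ kept_sign e H.
Proof.
move=> ret; rewrite negb_and negb_or !negbK ret andbT; apply/orP; right.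
apply/negPn/negP => /not_redundant[k [d [lte [_ no ha bt]]]]; apply: no.
have sB : base false (e, false) H \subset base k d H.
  by apply/subsetP=> g; rewrite !inE /= => /andP[/(lt_tr lte)-> ->]; rewrite orbT.
exact: reach_trans ha (reach_trans (reach_mono sB (ret false)) bt).
Qed.

Lemma descending_enum :
  exists s, pairwise (fun e f => lt f e) s /\ forall e, e \in s.
Proof.
pose ge e f := (e == f) || lt f e.
have ge_tr : transitive ge.
  move=> f e g /predU1P[->//|fe] /predU1P[<-|gf]; rewrite /ge ?fe ?orbT //.
  by rewrite (lt_tr gf fe) orbT.
have ge_total : total ge.
  move=> e f; rewrite /ge; have [//|/lt_total] := eqVneq e f.
  by rewrite orbC => ->; rewrite ?orbT.
exists (sort ge (enum (edge G))); split=> [|e]; last by rewrite mem_sort mem_enum.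
have uq : uniq (sort ge (enum (edge G))) by rewrite sort_uniq enum_uniq.
have := sort_sorted ge_total (enum (edge G)); rewrite sorted_pairwise //.
rewrite uniq_pairwise in uq; move=> pw.
have : pairwise [rel e f | (e != f) && ge e f] (sort ge (enum (edge G))).
  by rewrite pairwise_relI uq.
by apply: sub_pairwise => e f /= /andP[/negPf]; rewrite /ge => ->.
Qed.

(** * The map to subgraphs and its activities *)

Variable s : seq (edge G).
Variables (desc : pairwise (fun e f => lt f e) s) (full : forall e, e \in s).

Definition support O : subgraph G := bioriented (settle_all s O).

Lemma mem_flip_settled d O : (flip d \in settle_all s O) = (d \in settle_all s O).
Proof.
have := oriented_arcE d (settle_all s O); rewrite oriented_settle_all in_setD inE full /=.
by move/esym/negbT; rewrite negb_add => /eqP.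
Qed.

Lemma mem_support d O : (d.1 \in support O) = (d \in settle_all s O).
Proof.
rewrite inE (mem_flip_settled (d.1, true) O) andbb.
by case: d => e [] //=; rewrite -[RHS]mem_flip_settled.
Qed.

Lemma settle_all_support O : settle_all s O = arcs_of (support O).
Proof. by apply/setP=> d; rewrite inE mem_support. Qed.

Lemma support_fixed d O : d.1 \notin oriented O -> (d.1 \in support O) = (d \in O).
Proof.
rewrite mem_support; elim: s (O) => //= e s' IH H no.
rewrite IH; last by rewrite oriented_settle in_setD1 (negPf no) andbF.
by rewrite mem_settle; case: eqP => //= <-; rewrite (negPf no).
Qed.

(** The settled fourientation is [arcs_of (support O)], so the generalized activity asks the very
    query that settling preserves. *)
Lemma mem_Ihat_support d O : query true d O ->
  (d.1 \in Ihat lt (support O)) = ~~ returns true d O.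
Proof. by move=> qd; rewrite mem_Ihat -settle_all_support returns_settle_all. Qed.

Lemma mem_Lhat_support d O : query false d O ->
  (d.1 \in Lhat lt (support O)) = returns false d O.
Proof. by move=> qd; rewrite mem_Lhat -settle_all_support returns_settle_all. Qed.

Lemma Ihat_oriented O : Ihat lt (support O) :&: oriented O = Io lt R O.
Proof.
apply/setP=> e; rewrite inE [RHS]inE andbC.
have [oe|//] := boolP (e \in oriented O).
have [d [de dO fO]] := oriented_arc oe; rewrite -{}de /= in oe *.
rewrite mem_Ihat_support /query ?fO ?dO //.
apply/idP/min_in_potential_cutP => [nret|[b [fb]]].
  by exists d.2; rewrite -surjective_pairing.
have [-> //|E] := @same_edge _ d (d.1, b) erefl.
by rewrite E flipK dO in fb.
Qed.

Lemma Lhat_oriented O : Lhat lt (support O) :&: oriented O = Lo lt R O.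
Proof.
apply/setP=> e; rewrite inE [RHS]inE andbC.
have [oe|//] := boolP (e \in oriented O).
have [d [de dO fO]] := oriented_arc oe; rewrite -{}de /= in oe *.
rewrite mem_Lhat_support /query ?fO ?dO //.
apply/idP/min_in_potential_cycleP => [ret|[b [bO]]].
  by exists d.2; rewrite -surjective_pairing.
have [-> //|E] := @same_edge _ d (d.1, b) erefl.
by rewrite E (negPf fO) in bO.
Qed.

(** Adding the arc with sign [sigma_u e] rules out cuts using [e] in the opposite direction; what is
    left is the one query on [e]. *)
Lemma Ihat_unoriented O :
  Ihat lt (support O) :&: unoriented O = Iu lt R sigma_u O.
Proof.
apply/setP=> e; rewrite inE [RHS]inE andbC.
have [ue|//] := boolP (e \in unoriented O); pose d := (e, sigma_u e).
have nO b : (e, b) \notin O by move: ue; rewrite inE => /andP[]; case: b.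
rewrite -[e \in Ihat _ _]/(d.1 \in _) mem_Ihat_support; last first.
  by rewrite /query (negPf (nO _)) eqxx orbT.
have bE b : base true (e, b) (d |: O) = base true d O.
  apply: base_eq => d' /lt_neq d'e; rewrite !inE.
  by have [E|//] := eqVneq d' d; rewrite E eqxx in d'e.
apply/idP/min_in_potential_cutP => [nret|[b []]].
  exists d.2; rewrite /returns bE; split=> //.
  by rewrite !inE (negPf (nO _)) orbF; apply/eqP => -[]; case: (sigma_u e).
rewrite !inE (negPf (nO _)) orbF /returns bE /flip /d.
by case: b; case: (sigma_u e); rewrite ?eqxx.
Qed.

Lemma Lhat_bioriented O :
  Lhat lt (support O) :&: bioriented O = Lb lt R sigma_b O.
Proof.
apply/setP=> e; rewrite inE [RHS]inE andbC.
have [be|//] := boolP (e \in bioriented O); pose d := (e, ~~ sigma_b e).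
have bO b : (e, b) \in O by move: be; rewrite inE => /andP[]; case: b.
rewrite -[e \in Lhat _ _]/(d.1 \in _) mem_Lhat_support; last first.
  by rewrite /query bO eqxx orbT.
have bE b : base false (e, b) (O :\ (e, sigma_b e)) = base false d O.
  apply: base_eq => d' /lt_neq d'e; rewrite !inE.
  by have [E|//] := eqVneq d' (e, sigma_b e); rewrite E eqxx in d'e.
apply/idP/min_in_potential_cycleP => [ret|[b []]].
  exists d.2; rewrite /returns bE; split=> //.
  by rewrite !inE bO andbT; apply/eqP => -[]; case: (sigma_b e).
rewrite !inE bO andbT /returns bE /d.
by case: b; case: (sigma_b e); rewrite ?eqxx.
Qed.

(** Activity in the final state makes the cut queries on [d.1] fail in both directions when it is
    settled, so the sign kept is [true]. *)
Lemma support_Ihat d O : d \in O -> flip d \notin O ->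
  d.1 \in Ihat lt (support O) -> (d.1 \in support O) = d.2.
Proof.
move=> dO fO eI; have [K [nK bK]] := settle_all_at desc (full d.1) dO fO.
rewrite mem_support => ->; rewrite kept_sign_bridge // => b.
have: (d.1, b).1 \in Ihat lt (support O) by [].
by rewrite mem_Ihat -settle_all_support /returns [base _ _ _]bK.
Qed.

Lemma support_Lhat d O : d \in O -> flip d \notin O ->
  d.1 \in Lhat lt (support O) -> (d.1 \in support O) = ~~ d.2.
Proof.
move=> dO fO eL; have [K [nK bK]] := settle_all_at desc (full d.1) dO fO.
rewrite mem_support => ->; rewrite (negPf (kept_sign_loop _)) ?eqbF_neg // => b.
have: (d.1, b).1 \in Lhat lt (support O) by [].
by rewrite mem_Lhat -settle_all_support /returns [base _ _ _]bK.
Qed.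

Lemma support_inj : injective (fun O => (support O, oriented O)).
Proof.
move=> O O' [E oE]; apply: (settle_all_inj (s := s) oE).
by rewrite !settle_all_support E.
Qed.

End Activity.

(** * Counting and assembly *)

Lemma card_subsets (T : finType) : #|{set T}| = 2 ^ #|T|.
Proof. by have := card_powerset [set: T]; rewrite powersetT !cardsT. Qed.

Theorem theorem3p6 (G : multigraph) (R : orientation G) (lt : rel (edge G))
    (lt_order : strict_total_order lt) (sigma_u sigma_b : edge G -> sign) :
  exists phi : fourientation G -> subgraph G,
    let I O := Ihat lt (phi O) in
    let L O := Lhat lt (phi O) in
    (forall S : subgraph G, exists O : fourientation G, phi O = S) /\
    (forall S : subgraph G,
       #|[set O : fourientation G | phi O == S]| = 2 ^ #|edge G|) /\
    bijective (fun O : fourientation G => (phi O, oriented O)) /\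
    (forall O : fourientation G,
       unoriented O :&: phi O = set0 /\ bioriented O \subset phi O) /\
    (forall O : fourientation G,
       [/\ I O :&: oriented O = Io lt R O,
           I O :&: unoriented O = Iu lt R sigma_u O,
           L O :&: oriented O = Lo lt R O
         & L O :&: bioriented O = Lb lt R sigma_b O]) /\
    (forall O : fourientation G,
       [/\ I O :&: oriented_pos O \subset phi O,
           (I O :&: oriented_neg O) :&: phi O = set0,
           L O :&: oriented_neg O \subset phi O
         & (L O :&: oriented_pos O) :&: phi O = set0]) /\
    (forall O : fourientation G, oriented O = set0 ->
       I O = Ihat lt (bioriented O) /\ L O = Lhat lt (bioriented O)).
Proof.
have [s [desc full]] := descending_enum lt_order.
pose phi := support R lt sigma_u sigma_b s; exists phi => I L.
have inj : injective (fun O => (phi O, oriented O)) by apply: support_inj.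
have bij : bijective (fun O => (phi O, oriented O)).
  (* There are twice as many arcs as edges, so both sides have the same cardinality and injectivity
     suffices. *)
  apply: inj_card_bij inj _; rewrite card_prod !card_subsets card_prod card_bool.
  by rewrite -expnD addnn muln2.
have fixed e O : e \notin oriented O -> (e \in phi O) = (e \in bioriented O).
  move=> no; have F b : (e \in phi O) = ((e, b) \in O).
    exact: (@support_fixed _ _ _ _ _ _ full (e, b)).
  by rewrite [RHS]inE -!F andbb.
have signed e O : e \in oriented O -> (e, true) \in O = ((e, false) \notin O).
  rewrite -[e \in _]/((e, true).1 \in _) oriented_arcE /flip /=.
  by case: (_ \in O) (_ \in O) => [] [].
case: (bij) => psi phiK psiK; split=> [S|].
  by exists (psi (S, set0)); have [] := psiK (S, set0).
split=> [S|].
  (* The fibre over [S] is parametrized by the possible sets of oriented edges. *)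
  have injS : injective (fun A => psi (S, A)) by move=> A B /(can_inj psiK)[].
  rewrite -card_subsets -cardsT -(card_imset _ injS); apply: eq_card => O.
  rewrite inE; apply/eqP/imsetP => [<-|[A _ ->]].
    by exists (oriented O); rewrite // -[RHS]phiK.
  by have [] := psiK (S, A).
split=> //; split=> [O|].
  split.
    apply/setP=> e; rewrite in_setI [RHS]inE; apply/andP => -[ue].
    rewrite fixed; last by rewrite !inE in ue *; rewrite ue.
    by move: ue; rewrite !inE => /andP[/negPf->].
  apply/subsetP=> e be; rewrite fixed //.
  by rewrite in_setC in_setU be orbT.
split=> [O|].
  split; [exact: Ihat_oriented | exact: Ihat_unoriented |
          exact: Lhat_oriented | exact: Lhat_bioriented].
split=> [O|O o0]; last first.
  suff E : phi O = bioriented O by rewrite /I /L E.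
  by apply/setP=> e; rewrite fixed // o0 inE.
have pos e : e \in oriented_pos O -> (e, true) \in O /\ flip (e, true) \notin O.
  by rewrite inE => /andP[oe tO]; rewrite -signed.
have neg e : e \in oriented_neg O -> (e, false) \in O /\ flip (e, false) \notin O.
  by rewrite inE => /andP[oe fO]; rewrite /flip /= signed // fO.
split.
- apply/subsetP=> e /setIP[eI /pos[tO fO]].
  exact: (@support_Ihat _ _ _ _ _ _ _ desc full (e, true)).
- apply/setP=> e; rewrite in_setI [RHS]inE; apply/andP => -[/setIP[eI /neg[tO fO]]].
  by rewrite [e \in _](@support_Ihat _ _ _ _ _ _ _ desc full (e, false)).
- apply/subsetP=> e /setIP[eI /neg[tO fO]].
  exact: (@support_Lhat _ _ _ _ _ _ _ desc full (e, false)).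
- apply/setP=> e; rewrite in_setI [RHS]inE; apply/andP => -[/setIP[eI /pos[tO fO]]].
  by rewrite [e \in _](@support_Lhat _ _ _ _ _ _ _ desc full (e, true)).
Qed.
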